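(* There are absolute constants $c_0>0$ and $C$ such that the following holds. Let $(X,\Pi)$ be a $d$-dimensional $\gamma$-non-lazy $(\delta,\gamma)$-eposet, $k<d$, with $\gamma\le c_0\frac{\max_i\{\delta_i(1-\delta_{i-1})\}}{k^5R_{\max}^2}$, and let $f\in C_k$ have HD-Level-Set Decomposition $f=f_0+\dots+f_k$. Let $c$ denote a quantity with $c\le C\frac{k^5R_{\max}^2}{\max_i\{\delta_i(1-\delta_{i-1})\}}$. If $f$ is $(\varepsilon_1,\dots,\varepsilon_\ell)$-$\ell_\infty$-pseudorandom, then for all $1\le i\le\ell$, \[|\langle f,f_i\rangle|\le(R(k,i)+c\gamma)\varepsilon_i^2+c\gamma\|f\|^2,\] and if moreover $f$ has $i$-local constant sign, then \[|\langle f,f_i\rangle|\le(R(k,i)+c\gamma)\varepsilon_i|\mathbb E[f]|+c\gamma\|f\|^2.\]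
   Context: A $d$-dimensional graded poset is a poset $(X,<)$ with a rank function partitioning $X=X(0)\cup\dots\cup X(d)$, ranks increasing along $<$ and covers raising rank by one; $y\lessdot x$ means $y<x$ with rank$(x)=$rank$(y)+1$. Standing assumptions: $|X(0)|=1$, all maximal elements have rank $d$, and $X$ is regular: every $x\in X(k)$ is greater than exactly $R(k,i)$ elements of $X(i)$, and the number of maximal chains between comparable $x_k\in X(k)$, $x_i\in X(i)$ depends only on $k,i$. A probability distribution $\pi_d$ on $X(d)$ induces $\pi_i(x)=\frac{1}{R(i+1,i)}\sum_{y\gtrdot x}\pi_{i+1}(y)$. $C_k$ = real functions on $X(k)$, $\langle f,g\rangle=\sum_\tau\pi_k(\tau)f(\tau)g(\tau)$, $\|f\|=\langle f,f\rangle^{1/2}$, $\mathbb E[f]=\sum_\tau\pi_k(\tau)f(\tau)$. $U_if(y)=\frac{1}{R(i+1,i)}\sum_{x\lessdot y}f(x)$, $D_{i+1}f(x)=\frac{\sum_{y\gtrdot x}\pi_{i+1}(y)f(y)}{\sum_{y\gtrdot x}\pi_{i+1}(y)}$, $U^k_i=U_{k-1}\cdots U_i$, $D^k_i=D_{i+1}\cdots D_k$. $(X,\Pi)$ is a $(\delta,\gamma)$-eposet ($\delta\in[0,1]^{d-1}$, $\gamma<1$) if $\|D_{i+1}U_i-(1-\delta_i)I-\delta_iU_{i-1}D_i\|\le\gamma$ for $1\le i\le d-1$; $\gamma$-non-lazy if for every $1\le i\le d$ and $\sigma\in X(i)$ the walk $U_{i-1}D_i$ returns from $\sigma$ to $\sigma$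 with probability at most $\gamma$. HD-Level-Set Decomposition: $H^0=C_0$, $H^i=\ker D_i$, $V^i_k=U^k_iH^i$; for small $\gamma$, $C_k=\bigoplus_iV^i_k$ and $f=\sum f_i$, $f_i\in V^i_k$. $f$ is $(\varepsilon_1,\dots,\varepsilon_\ell)$-$\ell_\infty$-pseudorandom if $\|D^k_if-\mathbb E[f]\|_\infty\le\varepsilon_i$ for all $1\le i\le\ell$. For $s\in X(i)$ let $X_s=\{y\in X(k):y>s\}$ and $\mathbb E_{X_s}[f]=\frac{\sum_{y\in X_s}\pi_k(y)f(y)}{\sum_{y\in X_s}\pi_k(y)}$; $f$ has $i$-local constant sign if $\mathbb E[f]\ne0$ and for every $s\in X(i)$ with $\mathbb E_{X_s}[f]\ne0$, $\mathrm{sign}(\mathbb E_{X_s}[f])=\mathrm{sign}(\mathbb E[f])$. $R_{\max}=\max_{0\le i\le k}R(k,i)$. *)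

(* Defs.v *)
From HB Require Import structures.
From mathcomp Require Import all_boot all_order all_algebra.
From mathcomp Require Import reals.

Set Implicit Arguments.
Unset Strict Implicit.
Unset Printing Implicit Defensive.

Import Order.TTheory GRing.Theory Num.Theory.
Local Open Scope ring_scope.

(* A graded poset is a finite poset [X] with a rank function [rk : X -> nat];
   X(i) is the set of elements of rank i.  The numbers R(k,i) are given by
   [r : nat -> nat -> nat]. *)

Section Poset.
Context {disp : Order.disp_t} {X : finPOrderType disp}.
Variables (d : nat) (rk : X -> nat) (r : nat -> nat -> nat).

Definition covers (x y : X) : Prop :=
  (x < y)%O /\ forall z : X, ~ (x < z < y)%O.

Definition lessdot : rel X := [rel y x | (y < x)%O && (rk x == (rk y).+1)].

Record graded_poset : Prop := GradedPoset {
  rank_le : forall x, (rk x <= d)%N;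
  rank_lt : forall x y, (x < y)%O -> (rk x < rk y)%N;
  rank_cover : forall x y, covers x y -> rk y = (rk x).+1 }.

(* The maximal chains between x and y are the chains x = x_i <. ... <. x_k = y,
   encoded by the tuple (x_(i+1), ..., x_k). *)
Definition nb_max_chains (x y : X) : nat :=
  #|[set s : (rk y - rk x).-tuple X | path lessdot x s && (last x s == y)]|.

(* The non-strict order in [regular_below] only adds the convention R(k,k) = 1. *)
Record regular_poset : Prop := RegularPoset {
  regular_below : forall (x : X) (i : nat), (i <= rk x)%N ->
    #|[set y : X | (y <= x)%O && (rk y == i)]| = r (rk x) i;
  regular_chains : exists m : nat -> nat -> nat,
    forall x y : X, (x < y)%O -> nb_max_chains x y = m (rk y) (rk x) }.

Record standing_poset : Prop := StandingPoset {
  standing_graded : graded_poset;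
  standing_bottom : #|[set x : X | rk x == 0%N]| = 1%N;
  standing_pure : forall x : X, (forall y : X, ~ (x < y)%O) -> rk x = d;
  standing_regular : regular_poset }.

Definition Rmax (k : nat) : nat := \max_(i < k.+1) r k i.

Section Functions.
Variables (R : realType) (pi : X -> R).

(* [pi] collects all the distributions: pi_i is its restriction to X(i). *)
Record induced_distribution : Prop := InducedDistribution {
  top_ge0 : forall x, rk x = d -> 0 <= pi x;
  top_sum1 : \sum_(x | rk x == d) pi x = 1;
  pi_induced : forall x, (rk x < d)%N ->
    pi x = (r (rk x).+1 (rk x))%:R^-1 * \sum_(y | lessdot x y) pi y }.

(* A function in C_k is represented by any f : X -> R extending it; only the
   values of f on X(k) are ever used. *)
Definition inner (k : nat) (f g : X -> R) : R :=
  \sum_(x | rk x == k) pi x * f x * g x.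

Definition norm (k : nat) (f : X -> R) : R := Num.sqrt (inner k f f).

Definition expect (k : nat) (f : X -> R) : R := \sum_(x | rk x == k) pi x * f x.

(* On X(i+1), [up f] is U_i f; on X(i), [down f] is D_(i+1) f.  Full support of
   [pi] is not required: [down f] is 0 at points of mass 0. *)
Definition up (f : X -> R) : X -> R :=
  fun y => (r (rk y) (rk y).-1)%:R^-1 * \sum_(x | lessdot x y) f x.

Definition down (f : X -> R) : X -> R :=
  fun x => (\sum_(y | lessdot x y) pi y * f y) / (\sum_(y | lessdot x y) pi y).

Definition up_iter (k i : nat) (f : X -> R) : X -> R := iter (k - i) up f.

Definition down_iter (k i : nat) (f : X -> R) : X -> R := iter (k - i) down f.

(* Operator norm at most c, for an operator on C_k. *)
Definition opnorm_le (k : nat) (T : (X -> R) -> (X -> R)) (c : R) : Prop :=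
  forall f : X -> R, norm k (T f) <= c * norm k f.

(* delta_1, ..., delta_(d-1) are the parameters; delta_0 = 0 is the convention
   giving a meaning to delta_(i-1) for i = 1, consistently with D_1 U_0 = I. *)
Record eposet (delta : nat -> R) (gamma : R) : Prop := Eposet {
  eposet_delta0 : delta 0%N = 0;
  eposet_delta : forall i, (1 <= i < d)%N -> 0 <= delta i <= 1;
  eposet_gamma : gamma < 1;
  eposet_norm : forall i, (1 <= i < d)%N ->
    opnorm_le i
      (fun f x => down (up f) x - (1 - delta i) * f x - delta i * up (down f) x)
      gamma }.

Definition delta_max (delta : nat -> R) : R :=
  \big[Num.max/0]_(1 <= i < d) (delta i * (1 - delta i.-1)).

Definition indicator (s : X) : X -> R := fun x => (x == s)%:R.

Definition return_prob (s : X) : R := up (down (indicator s)) s.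

Definition non_lazy (gamma : R) : Prop :=
  forall (i : nat) (s : X), (1 <= i <= d)%N -> rk s = i -> return_prob s <= gamma.

Definition in_H (i : nat) (h : X -> R) : Prop :=
  (0 < i)%N -> forall x, rk x = i.-1 -> down h x = 0.

Definition in_V (k i : nat) (g : X -> R) : Prop :=
  exists2 h : X -> R, in_H i h & forall x, rk x = k -> g x = up_iter k i h x.

Definition HD_level_set_decomposition
    (k : nat) (f : X -> R) (fs : nat -> X -> R) : Prop :=
  (forall i, (i <= k)%N -> in_V k i (fs i)) /\
  (forall x, rk x = k -> f x = \sum_(i < k.+1) fs i x).

Definition linf_pseudorandom
    (k l : nat) (eps : nat -> R) (f : X -> R) : Prop :=
  forall i, (1 <= i <= l)%N ->
  forall x, rk x = i -> `|down_iter k i f x - expect k f| <= eps i.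

(* The non-strict order gives X_s = {s} when s has rank k, and agrees with the
   strict one when s has smaller rank. *)
Definition local_expect (k : nat) (s : X) (f : X -> R) : R :=
  (\sum_(y | (rk y == k) && (s <= y)%O) pi y * f y) /
  (\sum_(y | (rk y == k) && (s <= y)%O) pi y).

Definition local_constant_sign (k i : nat) (f : X -> R) : Prop :=
  expect k f <> 0 /\
  forall s, rk s = i -> local_expect k s f <> 0 ->
    Num.sg (local_expect k s f) = Num.sg (expect k f).

End Functions.
End Poset.

(* Main.v *)
(* On X(i), commuting D past U with the eposet relation shows that D^n U^n acts
   on H^i as a scalar p, up to O(k^2 gamma), and that the lifts U^(k-i) H^i are
   almost orthogonal.  The scalar is identified with 1/R(k,i) by looking at a
   diagonal entry of D^n U^n: regularity makes it exactly 1/R(k,i), while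
   non-laziness makes the contribution of the lower levels O(gamma).

   Write f_i = U^(k-i) h_i, g = D^k_i f and N = |g - E f|.  Since h_i is
   orthogonal to constants, a = <f, f_i> = <g - E f, h_i> satisfies
   a^2 <= N^2 |h_i|^2, and |h_i|^2 <= R(k,i) (|a| + O(gamma) |f|^2).  Together
   these give |a| <= R(k,i) N^2 + O(gamma) |f|^2, without a square-root loss in
   gamma, and it remains to bound N^2 pointwise. *)

Require Import Defs.
From HB Require Import structures.
From mathcomp Require Import all_boot all_order all_algebra.
From mathcomp Require Import reals boolp.
From mathcomp Require Import ring lra zify.

Set Implicit Arguments.
Unset Strict Implicit.
Unset Printing Implicit Defensive.

Import Order.TTheory GRing.Theory Num.Theory.
Local Open Scope ring_scope.

(** * The inner product weighted by [pi] *)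

Section InnerProduct.
Context (disp : Order.disp_t) (X : finPOrderType disp) (rk : X -> nat).
Context (R : realType) (pi : X -> R).
Hypothesis pi_ge0 : forall x, 0 <= pi x.
Implicit Types f g h : X -> R.

Local Notation ip := (inner rk pi).
Local Notation nrm := (norm rk pi).

Lemma eq_inner k f f' g g' :
  (forall x, rk x = k -> f x = f' x) -> (forall x, rk x = k -> g x = g' x) ->
  ip k f g = ip k f' g'.
Proof. by move=> ef eg; apply: eq_bigr => x /eqP xk; rewrite ef // eg. Qed.

Lemma eq_norm k f f' : (forall x, rk x = k -> f x = f' x) -> nrm k f = nrm k f'.
Proof. by move=> ef; rewrite /norm (eq_inner ef ef). Qed.

Lemma innerC k f g : ip k f g = ip k g f.
Proof. by apply: eq_bigr => x _; ring. Qed.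

Lemma inner_lin k a b f g h :
  ip k (fun x => a * f x + b * g x) h = a * ip k f h + b * ip k g h.
Proof. by rewrite /inner !mulr_sumr -big_split; apply: eq_bigr => x _ /=; ring. Qed.

Lemma inner_ge0 k f : 0 <= ip k f f.
Proof. by apply: sumr_ge0 => x _; rewrite -mulrA mulr_ge0 // -expr2 sqr_ge0. Qed.

Lemma norm_ge0 k f : 0 <= nrm k f.
Proof. exact: sqrtr_ge0. Qed.

Lemma sqr_norm k f : nrm k f ^+ 2 = ip k f f.
Proof. by rewrite sqr_sqrtr // inner_ge0. Qed.

(** Lagrange's identity: twice the Gram determinant is the double sum of pi x pi y (f x g y - g x f
    y)^2, also for weights that vanish somewhere. *)
Lemma cauchy_schwarz k f g : `|ip k f g| <= nrm k f * nrm k g.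
Proof.
suff H : ip k f g ^+ 2 <= ip k f f * ip k g g.
  by rewrite -sqrtrM ?inner_ge0 // -sqrtr_sqr ler_wsqrtr.
have e f1 f2 g1 g2 : ip k f1 f2 * ip k g1 g2 =
    \sum_(x | rk x == k) \sum_(y | rk y == k)
      pi x * pi y * (f1 x * f2 x * g1 y * g2 y).
  rewrite /inner mulr_suml; apply: eq_bigr => x _.
  by rewrite mulr_sumr; apply: eq_bigr => y _; ring.
suff : 0 <= ip k f f * ip k g g + ip k g g * ip k f f - 2 * (ip k f g * ip k f g).
  by rewrite expr2; lra.
rewrite !e mulr_sumr -big_split -sumrB; apply: sumr_ge0 => x _ /=.
rewrite mulr_sumr -big_split -sumrB; apply: sumr_ge0 => y _ /=.
have -> : pi x * pi y * (f x * f x * g y * g y)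
    + pi x * pi y * (g x * g x * f y * f y)
    - 2 * (pi x * pi y * (f x * g x * f y * g y))
  = pi x * pi y * (f x * g y - g x * f y) ^+ 2 by ring.
by apply: mulr_ge0; [exact: mulr_ge0 | exact: sqr_ge0].
Qed.

Lemma ler_norm_lin k a b f g :
  nrm k (fun x => a * f x + b * g x) <= `|a| * nrm k f + `|b| * nrm k g.
Proof.
have p0 : 0 <= `|a| * nrm k f + `|b| * nrm k g.
  by rewrite addr_ge0 ?mulr_ge0 ?norm_ge0.
rewrite -(@ler_pXn2r _ 2) ?nnegrE ?norm_ge0 // sqr_norm inner_lin.
rewrite !(innerC _ _ (fun x => _ + _)) !inner_lin -!sqr_norm (innerC k g f).
have := cauchy_schwarz k f g; set A := nrm k f; set B := nrm k g; set P := ip k f g.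
move=> PAB.
have -> : a * (a * A ^+ 2 + b * P) + b * (a * P + b * B ^+ 2) =
  a ^+ 2 * A ^+ 2 + b ^+ 2 * B ^+ 2 + 2 * (a * b * P) by ring.
have H : a * b * P <= `|a| * `|b| * (A * B).
  apply: le_trans (ler_norm _) _; rewrite !normrM.
  by apply: ler_wpM2l; rewrite ?mulr_ge0.
rewrite sqrrD !exprMn !real_normK ?num_real //; lra.
Qed.

Lemma ler_normZ k a f : nrm k (fun x => a * f x) <= `|a| * nrm k f.
Proof.
have := ler_norm_lin k a 0 f f; rewrite normr0 mul0r addr0.
by rewrite (@eq_norm _ _ (fun x => a * f x)) // => x _; rewrite mul0r addr0.
Qed.

Lemma expectE k f : expect rk pi k f = ip k f (fun=> 1).
Proof. by apply: eq_bigr => x _; rewrite mulr1. Qed.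

Lemma inner_indicator k f s : rk s = k -> ip k f (indicator R s) = pi s * f s.
Proof.
move=> sk; rewrite /inner (bigD1 s) /=; last by rewrite sk.
rewrite /indicator eqxx mulr1 big1 ?addr0 // => x /andP[_ /negbTE->].
by rewrite mulr0.
Qed.

End InnerProduct.

(** * Linearity of U and D *)

Section Linearity.
Context (disp : Order.disp_t) (X : finPOrderType disp).
Context (rk : X -> nat) (r : nat -> nat -> nat).
Context (R : realType) (pi : X -> R).
Implicit Types f g h : X -> R.

Local Notation up := (@up disp X rk r R).
Local Notation down := (@down disp X rk R pi).

Lemma up_lin a b f g :
  up (fun x => a * f x + b * g x) = fun x => a * up f x + b * up g x.
Proof.
apply: funext => x; rewrite /Defs.up big_split /= -!mulr_sumr; ring.
Qed.

Lemma down_lin a b f g :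
  down (fun x => a * f x + b * g x) = fun x => a * down f x + b * down g x.
Proof.
apply: funext => x; rewrite /Defs.down !mulrA -mulrDl !mulr_sumr -big_split /=.
by congr (_ / _); apply: eq_bigr => y _; ring.
Qed.

Lemma iter_down_lin n a b f g :
  iter n down (fun x => a * f x + b * g x) =
  fun x => a * iter n down f x + b * iter n down g x.
Proof. by elim: n => //= n ->; rewrite down_lin. Qed.

Lemma iter_up_sum n f x :
  iter n up f x = \sum_s f s * iter n up (indicator R s) x.
Proof.
elim: n x => [|n IH] x /=.
  rewrite (bigD1 x) //= /indicator eqxx mulr1 big1 ?addr0 // => s.
  by rewrite eq_sym => /negbTE->; rewrite mulr0.
rewrite /Defs.up (eq_bigr _ (fun y _ => IH y)) exchange_big mulr_sumr /=.
by apply: eq_bigr => s _; rewrite -mulr_sumr; ring.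
Qed.

End Linearity.

(** * Combinatorics of the poset: existence and number of chains *)

Section StandingPoset.
Context (disp : Order.disp_t) (X : finPOrderType disp).
Context (d : nat) (rk : X -> nat) (r : nat -> nat -> nat).
Hypothesis standX : standing_poset d rk r.

Local Notation ldot := (lessdot rk).

Let gradX : graded_poset d rk := standing_graded standX.
Let regX : regular_poset rk r := standing_regular standX.

Lemma exists_above (x : X) : (rk x < d)%N -> exists2 y, (x < y)%O & rk y = (rk x).+1.
Proof.
move=> xd; have [y0 xy0] : exists y, (x < y)%O.
  apply: contrapT => nx; move: xd; rewrite (standing_pure standX) ?ltnn // => y xy.
  by apply: nx; exists y.
have [y xy ymin] := @arg_minnP _ y0 (fun y => (x < y)%O) rk xy0.
exists y => //; apply: (rank_cover gradX); split=> // z /andP[xz zy].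
by have := ymin z xz; rewrite leqNgt (rank_lt gradX zy).
Qed.

(** Climbs from the bottom to rank i and then n ranks further; such a pair shows that R(i+n,i) is
    positive. *)
Lemma exists_chain n i : (i + n <= d)%N ->
  exists x y : X, [/\ rk x = i, rk y = (i + n)%N & (x <= y)%O].
Proof.
elim: n => [|n IH].
  rewrite addn0; elim: i => [_|i IHi id].
    have /eqP/cards1P[x /setP/(_ x)] := standing_bottom standX.
    by rewrite !inE eqxx => /eqP x0; exists x, x.
  have [x [_ [xi _ _]]] := IHi (ltnW id).
  have [|y _ yi] := @exists_above x; first by rewrite xi.
  by exists y, y; rewrite yi xi.
rewrite addnS => ind; have [x [y [xi yi xy]]] := IH (ltnW ind).
have [|z yz zi] := @exists_above y; first by rewrite yi.
by exists x, z; rewrite zi yi xi (le_trans xy (ltW yz)).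
Qed.

Lemma r_gt0 k i : (i <= k)%N -> (k <= d)%N -> (0 < r k i)%N.
Proof.
move=> ik kd; have [|x [y [xi yi xy]]] := @exists_chain (k - i) i.
  by rewrite subnKC.
rewrite subnKC // in yi.
have := @regular_below _ _ _ _ regX y i; rewrite yi => <- //; apply/card_gt0P.
by exists x; rewrite inE xy xi eqxx.
Qed.

Lemma rk_inj_le (x y : X) : (x <= y)%O -> rk x = rk y -> x = y.
Proof.
rewrite le_eqVlt => /predU1P[//|/(rank_lt gradX)] + xy.
by rewrite xy ltnn.
Qed.

Lemma card_lessdot (y : X) i : rk y = i.+1 -> #|[set x | ldot x y]| = r i.+1 i.
Proof.
move=> yi; have := @regular_below _ _ _ _ regX y i; rewrite yi leqnSn => <- //.
apply: eq_card => x; rewrite !inE /lessdot /= yi eqSS (eq_sym i).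
case: (eqVneq (rk x) i) => xi; rewrite ?andbF // !andbT lt_neqAle.
by case: eqVneq => // xy; move: yi; rewrite -xy xi; lia.
Qed.

Lemma lessdot_rk (x y : X) : ldot x y -> rk y = (rk x).+1.
Proof. by case/andP=> _ /eqP. Qed.

Lemma rk0_unique (x y : X) : rk x = 0%N -> rk y = 0%N -> x = y.
Proof.
move=> x0 y0; have /eqP/cards1P[z /setP ez] := standing_bottom standX.
by have := ez x; have := ez y; rewrite !inE x0 y0 !eqxx => /esym/eqP-> /esym/eqP->.
Qed.

(** The length n is a free parameter, which allows induction on it; for n the difference of the
    ranks this is [nb_max_chains]. *)
Definition nchains n (x y : X) : nat :=
  #|[set s : n.-tuple X | path ldot x s && (last x s == y)]|.

Lemma nchains0 x y : nchains 0 x y = (x == y).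
Proof.
rewrite /nchains; case: (eqVneq x y) => xy.
  apply/eqP/cards1P; exists [tuple]; apply/setP=> t.
  by rewrite !inE (tuple0 t) /= xy eqxx.
apply/eqP; rewrite cards_eq0; apply/eqP/setP=> t.
by rewrite !inE (tuple0 t) /= (negbTE xy).
Qed.

Lemma nchainsS n x y :
  nchains n.+1 x y = (\sum_(z | ldot x z) nchains n z y)%N.
Proof.
rewrite /nchains -sum1_card.
under [RHS]eq_bigr => z _ do rewrite -sum1_card.
rewrite (pair_big_dep _ _ (fun z (t : n.-tuple X) => 1%N)) /=.
rewrite (reindex (fun p : X * n.-tuple X => [tuple of p.1 :: p.2])) /=.
  by apply: eq_bigl => -[z t]; rewrite !inE /= andbA.
exists (fun t => (thead t, [tuple of behead t])) => [[z t] _|t _] /=.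
  by rewrite theadE; congr (_, _); apply: val_inj.
by rewrite [RHS]tuple_eta.
Qed.

Lemma nchains_le n x y : ~~ (x <= y)%O -> nchains n x y = 0%N.
Proof.
elim: n x => [|n IH] x xy; first by rewrite nchains0; case: eqVneq xy => // ->; rewrite lexx.
rewrite nchainsS big1 // => z /andP[xz _]; apply: IH; apply: contra xy.
exact: le_trans (ltW xz).
Qed.

(** Regularity speaks of x < y only; for n = 0 one has x = y, and the empty chain is the only
    one. *)
Lemma nchains_const n i : exists m : nat, forall x y,
  rk x = i -> rk y = (i + n)%N -> (x <= y)%O -> nchains n x y = m.
Proof.
case: n => [|n].
  exists 1%N => x y xi yi xy; rewrite nchains0 (rk_inj_le xy) ?eqxx //.
  by rewrite xi yi addn0.
have [m mP] := regular_chains regX; exists (m (i + n.+1)%N i) => x y xi yi xy.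
rewrite -{1}yi -xi -mP; last first.
  rewrite lt_neqAle xy andbT; apply/eqP=> exy.
  by move: yi; rewrite -exy xi; lia.
by rewrite /nb_max_chains /nchains yi xi addnC addnK.
Qed.

(** * U^n as an average over the lower set *)

Section Up.
Context (R : realType).
Implicit Types f g h : X -> R.

Local Notation up := (@up disp X rk r R).

Lemma up1 i y : rk y = i.+1 -> (i < d)%N -> up (fun=> 1) y = 1.
Proof.
move=> yi id; rewrite /Defs.up yi /= sumr_const.
rewrite -cardsE (card_lessdot yi) mulVf // pnatr_eq0 -lt0n r_gt0 //.
Qed.

Lemma eq_up i f g y : rk y = i.+1 -> (forall x, rk x = i -> f x = g x) ->
  up f y = up g y.
Proof.
move=> yi efg; rewrite /Defs.up; congr (_ * _).
by apply: eq_bigr => x /lessdot_rk; rewrite yi => -[xi]; apply: efg.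
Qed.

Lemma eq_iter_up n i f g y : rk y = (i + n)%N -> (forall x, rk x = i -> f x = g x) ->
  iter n up f y = iter n up g y.
Proof.
elim: n y => [|n IH] y yi efg; first by apply: efg; rewrite yi addn0.
by apply: (@eq_up (i + n)); [rewrite yi addnS | move=> x xi; apply: IH].
Qed.

Lemma iter_up_const n i c y : rk y = (i + n)%N -> (i + n <= d)%N ->
  iter n up (fun=> c) y = c.
Proof.
elim: n y => [|n IH] y yi ind //=; rewrite addnS in yi ind.
rewrite (@eq_up (i + n) _ (fun=> c * 1 + 0 * 1)) ?up_lin ?(@up1 (i + n)) //.
  by rewrite mul0r addr0 mulr1.
by move=> x xi; rewrite mul0r addr0 mulr1; apply: IH => //; apply: ltnW.
Qed.

(** Expanding U^n over chains, every chain carries the same weight w, the product of 1/R(j+1,j) over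
    i <= j < i+n. *)
Lemma iter_up_nchains n i : exists w : R, forall s y,
  rk s = i -> rk y = (i + n)%N ->
  iter n up (indicator R s) y = w * (nchains n s y)%:R.
Proof.
elim: n i => [|n IH] i.
  by exists 1 => s y _ _ /=; rewrite nchains0 mul1r /indicator eq_sym.
have [w wP] := IH i.+1; exists ((r i.+1 i)%:R^-1 * w) => s y si yi.
rewrite iterSr iter_up_sum nchainsS natr_sum mulr_sumr [RHS]big_mkcond /=.
apply: eq_bigr => x _; rewrite /Defs.up.
have -> : \sum_(z | ldot z x) indicator R s z = (ldot s x)%:R.
  rewrite big_mkcond (bigD1 s) //= big1 ?addr0 => [|z /negbTE zs].
    by rewrite /indicator eqxx; case: (ldot s x).
  by rewrite /indicator zs; case: ifP.
case: ifP => sx; last by rewrite mulr0 mul0r.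
have xi := lessdot_rk sx; rewrite si in xi.
by rewrite xi mulr1 wP ?mulrA // yi addSnnS.
Qed.

(* Averaging along chains is averaging over the lower set, because the number
   of maximal chains only depends on the ranks. *)
Lemma iter_up_indicator n s y : rk y = (rk s + n)%N -> (rk s + n <= d)%N ->
  iter n up (indicator R s) y = (s <= y)%O%:R / (r (rk s + n) (rk s))%:R.
Proof.
set i := rk s => yi ind; have [w wP] := iter_up_nchains n i.
have [m mP] := nchains_const n i.
have H x : rk x = i -> iter n up (indicator R x) y = w * m%:R * (x <= y)%O%:R.
  move=> xi; rewrite wP //; case xy: (x <= y)%O; first by rewrite (mP x y) // mulr1.
  by rewrite nchains_le ?xy // !mulr0.
rewrite H //; suff -> : (r (i + n) i)%:R^-1 = w * m%:R by rewrite mulrC.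
have R0 : (r (i + n) i)%:R != 0 :> R by rewrite pnatr_eq0 -lt0n r_gt0 ?leq_addr.
apply: (mulIf R0); rewrite mulVf //.
(* The value w m is found from U^n 1 = 1, with 1 cut down to X(i) so that only indicators of rank i
   occur in the expansion. *)
rewrite -{1}(iter_up_const 1 yi ind) (@eq_iter_up n i _ (fun x => (rk x == i)%:R)) //.
  have := @regular_below _ _ _ _ regX y i; rewrite yi leq_addr => <- //.
  rewrite iter_up_sum.
  rewrite -sum1_card natr_sum mulr_sumr [RHS]big_mkcond /=.
  apply: eq_bigr => x _; rewrite inE.
  case: (eqVneq (rk x) i) => [/H->|_]; last by rewrite andbF mul0r.
  by case: ifP; rewrite andbT => ->; rewrite mul1r // mulr0.
by move=> x ->; rewrite eqxx.
Qed.

End Up.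
End StandingPoset.

(** * Adjointness and contraction of U and D, and conditional averages *)

Section InducedDistribution.
Context (disp : Order.disp_t) (X : finPOrderType disp).
Context (d : nat) (rk : X -> nat) (r : nat -> nat -> nat).
Context (R : realType) (pi : X -> R).
Hypothesis standX : standing_poset d rk r.
Hypothesis piX : induced_distribution d rk r pi.
Implicit Types f g h : X -> R.

Local Notation up := (@up disp X rk r R).
Local Notation down := (@down disp X rk R pi).
Local Notation ip := (inner rk pi).
Local Notation nrm := (norm rk pi).
Local Notation expect := (expect rk pi).

Lemma pi_ge0 x : 0 <= pi x.
Proof.
have [n] := ubnP (d - rk x); elim: n x => // n IH x dx.
have := rank_le (standing_graded standX) x; rewrite leq_eqVlt => /predU1P[xd|xd].
  exact: (top_ge0 piX).
rewrite (pi_induced piX) // mulr_ge0 ?invr_ge0 ?ler0n //.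
by apply: sumr_ge0 => y /lessdot_rk yx; apply: IH; rewrite yx; lia.
Qed.

(** Both sides are the sum over pairs x <. y of pi y f x g y / R(i+1,i), since the denominator in D
    is R(i+1,i) pi x. So U and D are adjoint. *)
Lemma inner_up f g i : (i < d)%N -> ip i.+1 (up f) g = ip i f (down g).
Proof.
move=> id; rewrite /inner.
transitivity (\sum_(x | rk x == i) \sum_(y | lessdot rk x y)
    (r i.+1 i)%:R^-1 * (pi y * f x * g y)).
  rewrite (exchange_big_dep (fun y => rk y == i.+1)) /=; last first.
    by move=> x y /eqP xi /lessdot_rk ->; rewrite xi.
  apply: eq_bigr => y /eqP yi; rewrite /Defs.up yi /= [LHS]mulrC !mulr_sumr.
  apply: eq_big => [x|x _]; last by ring.
  case xy: (lessdot rk x y); rewrite ?andbF // andbT.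
  by move: (lessdot_rk xy); rewrite yi => -[->]; rewrite eqxx.
apply: eq_bigr => x /eqP xi; rewrite -mulr_sumr.
have -> : \sum_(y | lessdot rk x y) pi y * f x * g y =
    f x * \sum_(y | lessdot rk x y) pi y * g y.
  by rewrite mulr_sumr; apply: eq_bigr => y _; ring.
rewrite (pi_induced piX) ?xi // /Defs.down.
(* If the mass above x is 0, [down] has the value 0 of a division by 0; every pi y in the sum is
   then 0, so both sides vanish. *)
have [S0|S0] := eqVneq (\sum_(y | lessdot rk x y) pi y) 0; last first.
  by field; rewrite S0 pnatr_eq0 -lt0n (r_gt0 standX).
rewrite big1 ?S0 ?mulr0 ?mul0r // => y xy.
have /(_ _ y xy)-> := psumr_eq0P _ S0; first by rewrite mul0r.
by move=> z _; apply: pi_ge0.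
Qed.

(** By adjointness this reduces to D 1 = 1, which holds wherever pi x is nonzero; other points
    contribute nothing. *)
Lemma expect_up f i : (i < d)%N -> expect i.+1 (up f) = expect i f.
Proof.
move=> id; rewrite !expectE inner_up //; apply: eq_bigr => x /eqP xi.
rewrite /Defs.down; have [p0|p0] := eqVneq (pi x) 0; first by rewrite p0 !mul0r.
congr (_ * _); under eq_bigr => y _ do rewrite mulr1.
rewrite divff //; apply: contra_neq p0 => S0.
by rewrite (pi_induced piX) ?xi // S0 mulr0.
Qed.

Lemma expect_iter_up n f i : (i + n <= d)%N -> expect (i + n) (iter n up f) = expect i f.
Proof.
elim: n => [|n IH]; first by rewrite addn0.
by rewrite addnS => ind; rewrite /= expect_up // IH // ltnW.
Qed.

Lemma expect1 i : (i <= d)%N -> expect i (fun=> 1) = 1.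
Proof.
move=> id; have := @expect_iter_up (d - i) (fun=> 1) i; rewrite subnKC // => <- //.
rewrite -[RHS](top_sum1 piX); apply: eq_bigr => x /eqP xd.
by rewrite (iter_up_const standX (i := i)) ?subnKC ?mulr1.
Qed.

Lemma inner_iter_up n f g i : (i + n <= d)%N ->
  ip (i + n) (iter n up f) g = ip i f (iter n down g).
Proof.
elim: n g => [|n IH] g; first by rewrite addn0.
by rewrite addnS => ind; rewrite /= inner_up // IH ?(ltnW ind) -?iterSr.
Qed.

Lemma exists_pi_gt0 i : (i <= d)%N -> exists2 x, rk x = i & 0 < pi x.
Proof.
move=> id; apply: contrapT => nx.
have := expect1 id; rewrite /Defs.expect big1 => [/eqP|x /eqP xi].
  by rewrite eq_sym oner_eq0.
rewrite mulr1; apply/eqP; apply/negPn/negP => px; apply: nx; exists x => //.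
by rewrite lt_neqAle eq_sym px pi_ge0.
Qed.

(** Jensen: (U f)^2 <= U (f^2) pointwise, by expanding a variance, and U preserves expectations. *)
Lemma norm_up f i : (i < d)%N -> nrm i.+1 (up f) <= nrm i f.
Proof.
move=> id; rewrite /norm ler_wsqrtr //.
have -> : ip i f f = expect i.+1 (up (fun x => f x ^+ 2)).
  by rewrite expect_up //; apply: eq_bigr => x _; rewrite expr2 mulrA.
apply: ler_sum => y /eqP yi; rewrite -mulrA ler_wpM2l ?pi_ge0 //.
set a := up f y; have : 0 <= up (fun x => (f x - a) ^+ 2) y.
  rewrite /Defs.up mulr_ge0 ?invr_ge0 ?ler0n //.
  by apply: sumr_ge0 => x _; apply: sqr_ge0.
have -> : (fun x => (f x - a) ^+ 2) =
    (fun x => 1 * (f x ^+ 2) + 1 * ((- 2 * a) * f x + a ^+ 2 * 1)).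
  by apply: funext => x; ring.
rewrite !up_lin (up1 standX _ yi) // -/a -expr2; lra.
Qed.

(** Duality: |D f|^2 = <U D f, f> <= |D f| |f|, and |D f| cancels when it is nonzero. *)
Lemma norm_down f i : (i < d)%N -> nrm i (down f) <= nrm i.+1 f.
Proof.
move=> id; have [->|n0] := eqVneq (nrm i (down f)) 0; first exact: norm_ge0.
have p : 0 < nrm i (down f) by rewrite lt_neqAle eq_sym n0 norm_ge0.
rewrite -(ler_pM2l p) -expr2 sqr_norm; last exact: pi_ge0.
rewrite -inner_up //; apply: le_trans (ler_norm _) _.
apply: le_trans (cauchy_schwarz rk pi_ge0 _ _ _) _.
by rewrite ler_wpM2r ?norm_ge0 ?norm_up.
Qed.

Lemma norm_iter_up n f i : (i + n <= d)%N -> nrm (i + n) (iter n up f) <= nrm i f.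
Proof.
elim: n => [|n IH]; first by rewrite addn0.
rewrite addnS => ind; exact: le_trans (norm_up _ ind) (IH (ltnW ind)).
Qed.

Lemma norm_iter_down n f i : (i + n <= d)%N ->
  nrm i (iter n down f) <= nrm (i + n) f.
Proof.
elim: n f => [|n IH] f; first by rewrite addn0.
rewrite addnS => ind; rewrite iterSr; apply: le_trans (IH _ (ltnW ind)) _.
exact: norm_down.
Qed.

(* Pairing with the indicator of s recovers the conditional averages above s. *)
Lemma sum_above n s f : (rk s + n <= d)%N ->
  \sum_(y | (rk y == rk s + n)%N && (s <= y)%O) pi y * f y =
  (r (rk s + n) (rk s))%:R * (pi s * iter n down f s).
Proof.
move=> snd; rewrite -(inner_indicator _ _ (erefl (rk s))) innerC -inner_iter_up //.
rewrite big_mkcondr mulr_sumr; apply: eq_bigr => y /eqP yn.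
rewrite (iter_up_indicator standX) //.
have r0 : (r (rk s + n) (rk s))%:R != 0 :> R.
  by rewrite pnatr_eq0 -lt0n (r_gt0 standX) ?leq_addr.
by case: ifP => _ /=; rewrite ?mulr1n ?mulr0n; field.
Qed.

(** Positive mass at s keeps the denominator nonzero; elements of mass 0 above s drop out of the
    sum, and induction applies to the others. *)
Lemma iter_down1 n s : (rk s + n <= d)%N -> 0 < pi s -> iter n down (fun=> 1) s = 1.
Proof.
elim: n s => // n IH s ind ps /=; rewrite addnS in ind.
rewrite /Defs.down.
have sd : (rk s < d)%N by lia.
rewrite (_ : \sum_(y | _) pi y * _ = \sum_(y | lessdot rk s y) pi y).
  rewrite divff //; apply: contraTneq ps => S0.
  by rewrite (pi_induced piX) // S0 mulr0 ltxx.
apply: eq_bigr => y sy; have [->|p0] := eqVneq (pi y) 0; first by rewrite mul0r.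
rewrite IH ?mulr1 ?(lessdot_rk sy) ?addSn //.
by rewrite lt_neqAle eq_sym p0 pi_ge0.
Qed.

Lemma eq_iter_down n i f g x : rk x = i -> (forall y, rk y = (i + n)%N -> f y = g y) ->
  iter n down f x = iter n down g x.
Proof.
elim: n i x => [|n IH] i x xi efg /=; first by apply: efg; rewrite addn0.
rewrite /Defs.down; congr (_ / _); apply: eq_bigr => y /lessdot_rk yx.
by rewrite (IH i.+1) ?yx ?xi // => z zi; apply: efg; rewrite zi addSnnS.
Qed.

(** [sum_above] for f and for 1 has the same factor in front, which cancels. This links the local
    sign condition to D^k_i f. *)
Lemma local_expect_down n s f : (rk s + n <= d)%N -> 0 < pi s ->
  local_expect rk pi (rk s + n) s f = iter n down f s.
Proof.
move=> ind ps; rewrite /local_expect sum_above //.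
have := sum_above (fun=> 1) ind; under eq_bigr => y _ do rewrite mulr1.
rewrite iter_down1 // => ->.
have r0 : (r (rk s + n) (rk s))%:R != 0 :> R.
  by rewrite pnatr_eq0 -lt0n (r_gt0 standX) ?leq_addr.
by field; rewrite r0 gt_eqF.
Qed.

End InducedDistribution.

(** * Commuting D past U^n in an eposet *)

Section Eposet.
Context (disp : Order.disp_t) (X : finPOrderType disp).
Context (d : nat) (rk : X -> nat) (r : nat -> nat -> nat).
Context (R : realType) (pi : X -> R) (delta : nat -> R) (gamma : R).
Hypothesis standX : standing_poset d rk r.
Hypothesis piX : induced_distribution d rk r pi.
Hypothesis epoX : eposet d rk r pi delta gamma.
Hypothesis lazyX : non_lazy d rk r pi gamma.
Implicit Types f g h : X -> R.

Local Notation up := (@up disp X rk r R).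
Local Notation down := (@down disp X rk R pi).
Local Notation ip := (inner rk pi).
Local Notation nrm := (norm rk pi).
Local Notation expect := (expect rk pi).
Let pi0 := pi_ge0 standX piX.

Lemma delta_ge0_le1 i : (i < d)%N -> 0 <= delta i <= 1.
Proof.
case: i => [_|i id]; first by rewrite (eposet_delta0 epoX) lexx ler01.
exact: (eposet_delta epoX).
Qed.

(** The coefficient of U^n D when D is moved past U^n on X(m+1). *)
Definition mu (m n : nat) : R := \prod_(s < n) delta (m.+1 + s).

Lemma mu_ge0_le1 m n : (m + n < d)%N -> 0 <= mu m n <= 1.
Proof.
move=> mnd; have H (s : 'I_n) : 0 <= delta (m.+1 + s) <= 1.
  by apply: delta_ge0_le1; have := ltn_ord s; lia.
rewrite prodr_ge0 => [|s _]; last by case/andP: (H s).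
by rewrite prodr_ile1.
Qed.

(** Non-laziness at an element of rank 1: a return probability is nonnegative. *)
Lemma gamma_ge0 : (0 < d)%N -> 0 <= gamma.
Proof.
move=> d0; have [s s1 _] := exists_pi_gt0 standX piX d0.
apply: le_trans (lazyX _ s1); last by rewrite d0.
rewrite /return_prob /Defs.up mulr_ge0 ?invr_ge0 ?ler0n // sumr_ge0 // => x _.
rewrite /Defs.down mulr_ge0 ?invr_ge0 ?sumr_ge0 // => y _.
by rewrite mulr_ge0 // ler0n.
Qed.

Definition comm_err (m n : nat) h : X -> R := fun x =>
  down (iter n up h) x - (1 - mu m n) * iter n.-1 up h x
  - mu m n * iter n up (down h) x.

(* D U^n = (1 - mu_n) U^(n-1) + mu_n U^n D on X(m+1), up to n gamma: the
   coefficients obey mu_(n+1) = delta_(m+1+n) mu_n.  At n = 0 the junk value of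
   n.-1 is harmless because 1 - mu_0 = 0. *)
Lemma norm_comm_err m n h : (m.+1 + n <= d)%N ->
  nrm (m + n) (comm_err m n h) <= n%:R * gamma * nrm m.+1 h.
Proof.
elim: n => [|n IH] mnd.
  rewrite addn0 (@eq_norm _ _ _ _ _ _ _ (fun x => 0 * h x)).
    by apply: le_trans (ler_normZ rk pi0 _ _ _) _; rewrite normr0 !mul0r.
  by move=> x _; rewrite /comm_err /mu big_ord0 /=; ring.
have d0 : (0 < d)%N by lia.
set u := iter n up h; set t := (m.+1 + n)%N.
pose T f := fun x =>
  down (up f) x - (1 - delta t) * f x - delta t * up (down f) x.
(* The error for n+1 is the eposet defect [T] of U^n h plus delta_t U applied to the error for n, so
   each step costs gamma. The factor 1 keeps the shape a f + b g of the linearity lemmas. *)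
have -> : comm_err m n.+1 h = fun x => 1 * T u x + delta t * up (comm_err m n h) x.
  apply: funext => x.
  have -> : comm_err m n h = fun y => 1 * (1 * down u y + (- (1 - mu m n)) * iter n.-1 up h y)
      + (- mu m n) * iter n up (down h) y.
    by apply: funext => y; rewrite /comm_err -/u; ring.
  rewrite !up_lin /comm_err /T /=.
  rewrite [mu m n.+1](_ : _ = delta t * mu m n); last first.
    by rewrite /mu big_ord_recr mulrC.
  rewrite -/u; have [n0|n0] := posnP n.
    rewrite /u n0 /mu big_ord0 /=; ring.
  have -> : up (iter n.-1 up h) x = u x by rewrite /u -{2}(prednK n0).
  ring.
rewrite addnS -addSn -/t; have td : (t < d)%N by rewrite /t; lia.
have /andP[dt0 dt1] := delta_ge0_le1 td.
apply: le_trans (ler_norm_lin rk pi0 _ _ _ _ _) _; rewrite normr1 mul1r (ger0_norm dt0).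
have HT : nrm t (T u) <= gamma * nrm m.+1 h.
  apply: (@le_trans _ _ (gamma * nrm t u)).
    by apply: (eposet_norm epoX); rewrite /t; lia.
  by rewrite ler_wpM2l ?gamma_ge0 // (norm_iter_up standX piX) // ltnW.
have HE : nrm t (up (comm_err m n h)) <= n%:R * gamma * nrm m.+1 h.
  apply: le_trans (IH (ltnW td)); rewrite /t addSn; apply: (norm_up standX piX).
  by rewrite -addSn ltnW.
have E0 : 0 <= nrm t (up (comm_err m n h)) by apply: norm_ge0.
rewrite -[n.+1]addn1 natrD; nra.
Qed.

(** The scalar by which D^n U^n nearly acts on the kernel of D in rank m+1: each replacement of D
    U^(s+1) by (1 - mu_(s+1)) U^s contributes a factor. *)
Definition pcoef (m n : nat) : R := \prod_(s < n) (1 - mu m s.+1).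

(** Exact: the innermost D is moved through U^(N+1) with [comm_err] as remainder. N is independent
    of n because off-diagonal terms have more U than D. *)
Lemma downup_step m n N h x :
  iter n.+1 down (iter N.+1 up h) x =
  1 * (1 * iter n down (comm_err m N.+1 h) x
   + (1 - mu m N.+1) * iter n down (iter N up h) x)
   + mu m N.+1 * iter n down (iter N.+1 up (down h)) x.
Proof.
rewrite iterSr -/(iter N.+1 up h).
have -> : down (iter N.+1 up h) = fun y =>
    1 * (1 * comm_err m N.+1 h y + (1 - mu m N.+1) * iter N up h y)
    + mu m N.+1 * iter N.+1 up (down h) y.
  by apply: funext => y; rewrite /comm_err /=; ring.
by rewrite !iter_down_lin.
Qed.

(** In [downup_step] with N = n the last term vanishes as D h = 0, the commutation error is at most
    k gamma |h|, and the factor 1 - mu <= 1 does not enlarge the error for n. *)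
Lemma norm_downup m n k h : (m.+1 + n <= k)%N -> (k <= d)%N ->
  (forall x, rk x = m -> down h x = 0) ->
  nrm m.+1 (fun x => iter n down (iter n up h) x - pcoef m n * h x)
  <= n%:R * k%:R * gamma * nrm m.+1 h.
Proof.
move=> mnk kd h0; elim: n mnk => [|n IH] mnk.
  rewrite (@eq_norm _ _ _ _ _ _ _ (fun x => 0 * h x)).
    by apply: le_trans (ler_normZ rk pi0 _ _ _) _; rewrite normr0 !mul0r.
  by move=> x _; rewrite /pcoef big_ord0 /=; ring.
have d0 : (0 < d)%N by lia.
have mnd : (m.+1 + n <= d)%N by lia.
have [k0 g0] : 0 <= k%:R :> R /\ 0 <= gamma by rewrite ler0n gamma_ge0.
have /andP[mu0 mu1] : 0 <= mu m n.+1 <= 1 by apply: mu_ge0_le1; lia.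
pose e := iter n down (comm_err m n.+1 h).
pose w x := iter n down (iter n up h) x - pcoef m n * h x.
pose z := iter n down (iter n.+1 up (down h)).
rewrite (@eq_norm _ _ _ _ _ _ _ (fun x => 1 * (1 * e x + (1 - mu m n.+1) * w x)
   + mu m n.+1 * z x)); last first.
  move=> x xm; rewrite (downup_step m) -/e /pcoef big_ord_recr /= -/(pcoef m n).
  rewrite /w /e /z /=; ring.
have nz : nrm m.+1 z = 0.
  apply/eqP; rewrite eq_le norm_ge0 andbT.
  apply: le_trans (norm_iter_down standX piX _ _) _; first by lia.
  rewrite addSnnS; apply: le_trans (norm_iter_up standX piX _ _) _; first by lia.
  rewrite (@eq_norm _ _ _ _ _ _ _ (fun x => 0 * h x)).
    by apply: le_trans (ler_normZ rk pi0 _ _ _) _; rewrite normr0 !mul0r.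
  by move=> x xm; rewrite h0 // mul0r.
have ne : nrm m.+1 e <= k%:R * gamma * nrm m.+1 h.
  apply: le_trans (norm_iter_down standX piX _ _) _; first by lia.
  rewrite addSnnS; apply: le_trans (norm_comm_err _ _) _ ; first by lia.
  apply: ler_wpM2r; first exact: norm_ge0.
  by apply: ler_wpM2r => //; rewrite ler_nat; lia.
apply: le_trans (ler_norm_lin rk pi0 _ _ _ _ _) _.
rewrite nz mulr0 addr0 normr1 mul1r.
apply: le_trans (ler_norm_lin rk pi0 _ _ _ _ _) _.
rewrite normr1 mul1r ger0_norm; last by lra.
have Hw : nrm m.+1 w <= n%:R * k%:R * gamma * nrm m.+1 h by apply: IH; lia.
have := norm_ge0 rk pi m.+1 w => w0.
have : (1 - mu m n.+1) * nrm m.+1 w <= nrm m.+1 w by rewrite ler_piMl //; lra.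
rewrite -[n.+1]addn1 natrD; lra.
Qed.

(** * Diagonal entries of D^n U^n at a point of positive mass *)

Section Diagonal.
Context (s : X).
Hypothesis pi_s : 0 < pi s.
Local Notation e_s := (indicator R s).

Lemma sqr_norm_indicator : nrm (rk s) e_s ^+ 2 = pi s.
Proof. by rewrite sqr_norm // inner_indicator // /indicator eqxx mulr1. Qed.

(** Turns norm bounds into pointwise ones: pi s |f s| = |<f, e_s>| <= |f| |e_s|, and |e_s|^2 = pi
    s. *)
Lemma eval_le f c : nrm (rk s) f <= c * nrm (rk s) e_s -> `|f s| <= c.
Proof.
move=> fc; rewrite -(ler_pM2l pi_s) -{1}(gtr0_norm pi_s) -normrM.
rewrite -(inner_indicator pi f (erefl (rk s))).
apply: le_trans (cauchy_schwarz rk pi0 _ _ _) _.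
rewrite -sqr_norm_indicator [leRHS]mulrC expr2 mulrA; apply: ler_wpM2r => //.
exact: norm_ge0.
Qed.

(** U^n e_s is the constant 1/R(k,i) above s, and D^n at s averages over the elements above s
    only. *)
Lemma downup_diag n : (rk s + n <= d)%N ->
  iter n down (iter n up e_s) s = (r (rk s + n) (rk s))%:R^-1.
Proof.
move=> snd; set R0 := (r (rk s + n) (rk s))%:R.
have r0 : R0 != 0 by rewrite pnatr_eq0 -lt0n (r_gt0 standX) ?leq_addr.
have p0 : pi s != 0 by rewrite gt_eqF.
have e1 := sum_above standX piX (iter n up e_s) snd.
have := sum_above standX piX (fun=> R0^-1 * 1 + 0 * 1) snd.
rewrite iter_down_lin (iter_down1 standX piX) // -/R0 => e2.
have : R0 * (pi s * iter n down (iter n up e_s) s) =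
       R0 * (pi s * (R0^-1 * 1 + 0 * 1)).
  rewrite -e1 -e2; apply: eq_bigr => y /andP[/eqP yi sy].
  by rewrite (iter_up_indicator standX) // sy mul0r addr0 mulr1 mul1r.
by rewrite mul0r addr0 mulr1 => /(mulfI r0)/(mulfI p0).
Qed.

(** |D e_s|^2 = <U D e_s, e_s> is pi s times the return probability, and the remaining D
    contract. *)
Lemma sqr_norm_down_indicator m q : rk s = (m + q.+1)%N -> (rk s <= d)%N ->
  nrm m (iter q.+1 down e_s) ^+ 2 <= gamma * pi s.
Proof.
move=> si sd; rewrite iterSr; apply: (@le_trans _ _ (nrm (m + q) (down e_s) ^+ 2)).
  by rewrite ler_sqr ?nnegrE ?norm_ge0 // (norm_iter_down standX piX); lia.
rewrite sqr_norm // -(inner_up standX piX); last by lia.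
rewrite inner_indicator; last by rewrite si addnS.
by rewrite mulrC ler_wpM2r // (lazyX (i := rk s)) // si addnS /= -addnS -si.
Qed.

(** Induction on n. For n = 0 the value times pi s is |D^(q+1) e_s|^2, bounded by non-laziness.
    Commuting one D gives an error k gamma plus the cases (n-1, q) and (n-1, q+1) with weights 1 -
    mu and mu. *)
Lemma offdiag_le n m q k : rk s = (m + q.+1)%N -> (rk s + n <= k)%N -> (k <= d)%N ->
  `|iter n down (iter (n + q.+1) up (iter q.+1 down e_s)) s| <=
  (1 + n%:R * k%:R) * gamma.
Proof.
move=> + + kd; have H0 m' q' : rk s = (m' + q'.+1)%N -> (rk s <= d)%N ->
    `|iter q'.+1 up (iter q'.+1 down e_s) s| <= gamma.
  move=> si sd; rewrite -(ler_pM2l pi_s) -{1}(gtr0_norm pi_s) -normrM.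
  rewrite -(inner_indicator pi _ si) (inner_iter_up standX piX); last by rewrite -si.
  rewrite -sqr_norm // ger0_norm ?sqr_ge0 // mulrC.
  exact: sqr_norm_down_indicator.
elim: n m q => [|n IH] [|m] q si snk.
- by rewrite mul0r addr0 mul1r; apply: (H0 0%N) => //; lia.
- by rewrite mul0r addr0 mul1r; apply: (H0 m.+1) => //; lia.
(* For m = 0 the function D^(q+1) e_s lives on the single point of X(0), so all its lifts are one
   constant, which D^n preserves at s; the case n = 0 then applies. *)
- have g0 : 0 <= gamma by apply: gamma_ge0; lia.
  have [x0 x00 _] := exists_pi_gt0 standX piX (leq0n d).
  set g := iter q.+1 down e_s.
  have up_g N y : rk y = N -> (N <= d)%N -> iter N up g y = g x0.
    move=> yN Nd; rewrite -[RHS](iter_up_const standX (i := 0) _ yN) //.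
    apply: (@eq_iter_up _ _ _ _ _ _ 0) => // x x0'.
    by rewrite (rk0_unique standX x0' x00).
  rewrite (@eq_iter_down _ _ rk R pi n.+1 (rk s) _ (fun=> g x0 * 1 + 0 * 1)) //; last first.
    by move=> y yi; rewrite mul0r addr0 mulr1 up_g //; lia.
  rewrite iter_down_lin (iter_down1 standX piX) //; last by lia.
  rewrite !mulr1 addr0 -(@up_g (rk s) s) //; last by lia.
  rewrite {1}si; apply: le_trans (H0 0%N q si _) _; first by lia.
  by rewrite ler_peMl // lerDl mulr_ge0 ?ler0n.
have g0 : 0 <= gamma by apply: gamma_ge0; lia.
rewrite addSn (downup_step m) !mul1r.
have /andP[mu0 mu1] : 0 <= mu m (n + q.+1).+1 <= 1 by apply: mu_ge0_le1; lia.
set g := iter q.+1 down e_s.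
have Herr : `|iter n down (comm_err m (n + q.+1).+1 g) s| <= k%:R * gamma.
  apply: eval_le.
  apply: le_trans (norm_iter_down standX piX _ _) _; first by lia.
  rewrite (_ : rk s + n = m + (n + q.+1).+1)%N; last by lia.
  apply: le_trans (norm_comm_err _ _) _ ; first by lia.
  apply: ler_pM; rewrite ?mulr_ge0 ?ler0n ?norm_ge0 //.
    by apply: ler_wpM2r => //; rewrite ler_nat; lia.
  by rewrite si; apply: (norm_iter_down standX piX); lia.
have H1 : `|iter n down (iter (n + q.+1) up g) s| <= (1 + n%:R * k%:R) * gamma.
  by apply: (IH m.+1) => //; lia.
have H2 : `|iter n down (iter (n + q.+1).+1 up (down g)) s| <= (1 + n%:R * k%:R) * gamma.
  by rewrite -addnS; apply: (IH m q.+1); lia.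
rewrite -[n.+1]addn1 natrD.
move: Herr H1 H2; rewrite !ler_norml => /andP[? ?] /andP[? ?] /andP[? ?].
apply/andP; split; nra.
Qed.

(** The diagonal entry and [pcoef] obey the same recursion up to a commutation error k gamma and an
    off-diagonal term (k + k^2) gamma; as k <= k^2, a step costs at most 3 k^2 gamma. *)
Lemma pcoef_approx m n k : rk s = m.+1 -> (rk s + n <= k)%N -> (k <= d)%N ->
  `|(r (rk s + n) (rk s))%:R^-1 - pcoef m n| <= n%:R * (3 * k%:R ^+ 2 * gamma).
Proof.
move=> si snk kd; rewrite -downup_diag; last by lia.
have g0 : 0 <= gamma by apply: gamma_ge0; lia.
elim: n snk => [|n IH] snk.
  by rewrite mul0r /pcoef big_ord0 /= /indicator eqxx subrr normr0.
have /andP[mu0 mu1] : 0 <= mu m n.+1 <= 1 by apply: mu_ge0_le1; lia.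
rewrite (downup_step m) !mul1r.
have k1 : 1 <= k%:R :> R by rewrite ler1n; lia.
have nk : n%:R <= k%:R :> R by rewrite ler_nat; lia.
have n0 : 0 <= n%:R :> R by rewrite ler0n.
have Herr : `|iter n down (comm_err m n.+1 e_s) s| <= k%:R * gamma.
  apply: eval_le.
  apply: le_trans (norm_iter_down standX piX _ _) _; first by lia.
  rewrite (_ : rk s + n = m + n.+1)%N; last by lia.
  apply: le_trans (norm_comm_err _ _) _ ; first by lia.
  rewrite si; apply: ler_wpM2r; first exact: norm_ge0.
  by apply: ler_wpM2r => //; rewrite ler_nat; lia.
have H1 : `|iter n down (iter n up e_s) s - pcoef m n| <= n%:R * (3 * k%:R ^+ 2 * gamma).
  by apply: IH; lia.
have H2 : `|iter n down (iter n.+1 up (down e_s)) s| <= (k%:R + k%:R ^+ 2) * gamma.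
  rewrite -addn1; apply: le_trans (@offdiag_le n m 0 k _ _ _) _; rewrite ?addn1 //.
    by lia.
  apply: ler_wpM2r => //; rewrite expr2 lerD //.
  by apply: ler_wpM2r => //; lra.
have kk : k%:R <= k%:R ^+ 2 :> R by rewrite expr2; nra.
have kg : k%:R * gamma <= k%:R ^+ 2 * gamma by apply: ler_wpM2r.
rewrite /pcoef big_ord_recr /= -/(pcoef m n).
set a := iter n down _ s in Herr *; set b := iter n down _ s in H1 *.
set c := iter n down _ s in H2 *; set p := pcoef m n in H1 *.
set t := mu m n.+1 in mu0 mu1 *.
rewrite (_ : _ - _ = a + (1 - t) * (b - p) + t * c); last by ring.
apply: le_trans (ler_normD _ _) _; apply: le_trans (lerD (ler_normD _ _) (lexx _)) _.
rewrite !normrM (ger0_norm mu0) (@ger0_norm _ (1 - t)) ?subr_ge0 // -[n.+1]addn1 natrD.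
have : (1 - t) * `|b - p| <= `|b - p| by rewrite ler_piMl //; lra.
have : t * `|c| <= `|c| by rewrite ler_piMl.
lra.
Qed.

End Diagonal.
End Eposet.

(** * Norms and near-orthogonality of the lifts *)

Section Decomposition.
Context (disp : Order.disp_t) (X : finPOrderType disp).
Context (d : nat) (rk : X -> nat) (r : nat -> nat -> nat).
Context (R : realType) (pi : X -> R) (delta : nat -> R) (gamma : R) (k : nat).
Hypothesis standX : standing_poset d rk r.
Hypothesis piX : induced_distribution d rk r pi.
Hypothesis epoX : eposet d rk r pi delta gamma.
Hypothesis lazyX : non_lazy d rk r pi gamma.
Hypotheses (k_gt0 : (0 < k)%N) (k_lt : (k < d)%N).
Implicit Types f g h : X -> R.

Local Notation up := (@up disp X rk r R).
Local Notation down := (@down disp X rk R pi).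
Local Notation ip := (inner rk pi).
Local Notation nrm := (norm rk pi).
Local Notation expect := (expect rk pi).
Local Notation Rm := ((Rmax r k)%:R : R).
Let pi0 := pi_ge0 standX piX.
Let kR := k%:R : R.
Hypothesis gamma_small : 8 * (Rm * kR ^+ 3 * gamma) <= 1.

Let kd : (k <= d)%N := ltnW k_lt.
Let g0 : 0 <= gamma.
Proof. by apply: (gamma_ge0 standX piX lazyX); apply: leq_trans kd. Qed.
Let k1 : 1 <= kR. Proof. by rewrite ler1n. Qed.

Lemma r_le_Rmax i : (i <= k)%N -> (r k i)%:R <= Rm.
Proof.
move=> ik; rewrite ler_nat -ltnS in ik *.
exact: (@leq_bigmax _ (fun j : 'I_k.+1 => r k j) (Ordinal ik)).
Qed.

Let r_ge1 i : (i <= k)%N -> 1 <= (r k i)%:R :> R.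
Proof. by move=> ik; rewrite ler1n (r_gt0 standX). Qed.
Let Rm_ge1 : 1 <= Rm.
Proof. exact: le_trans (r_ge1 (leq0n k)) (r_le_Rmax (leq0n k)). Qed.

Lemma norm_downup_in_H j h : (0 < j <= k)%N -> in_H rk pi j h ->
  nrm j (fun x => iter (k - j) down (iter (k - j) up h) x - pcoef delta j.-1 (k - j) * h x)
    <= kR ^+ 2 * gamma * nrm j h.
Proof.
case: j => // m mk hH.
have kk : (m.+1 + (k - m.+1) <= k)%N by lia.
apply: le_trans (norm_downup standX piX epoX lazyX kk kd (hH _)) _ => //.
apply: ler_wpM2r; first exact: norm_ge0.
apply: ler_wpM2r => //; rewrite expr2.
by apply: ler_wpM2r; rewrite ?ler0n // ler_nat; lia.
Qed.

(** |U^n h|^2 = <h, D^n U^n h> is p |h|^2 up to k^2 gamma |h|^2, and replacing p by 1/R(k,j) costs 3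
    k^3 gamma |h|^2. *)
Lemma norm_lift_approx j h : (0 < j <= k)%N -> in_H rk pi j h ->
  `|nrm k (iter (k - j) up h) ^+ 2 - (r k j)%:R^-1 * nrm j h ^+ 2|
    <= 4 * (kR ^+ 3 * gamma) * nrm j h ^+ 2.
Proof.
move=> jk hH; have H := norm_downup_in_H jk hH.
have jk' : (j + (k - j) = k)%N by lia.
have jd : (j <= d)%N by lia.
have [s sj ps] := exists_pi_gt0 standX piX jd.
case: j jk hH H jk' jd sj => // m mk hH H mk' md sm.
have := @pcoef_approx _ _ _ _ _ _ _ _ _ standX piX epoX lazyX s ps m (k - m.+1) k sm.
rewrite sm mk' => /(_ (leqnn k) kd) Hp.
rewrite sqr_norm // -{1}mk' (inner_iter_up standX piX) ?mk' //.
set p := pcoef _ _ _ in H Hp; set n := (k - m.+1)%N in H Hp *; set m' := m.+1 in H *.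
pose w x := iter n down (iter n up h) x - p * h x.
have -> : ip m' h (iter n down (iter n up h)) = 1 * ip m' w h + p * ip m' h h.
  rewrite -inner_lin innerC; apply: eq_inner => // x _; rewrite /w; ring.
rewrite -sqr_norm // in H *; rewrite -/w in H.
have Hw := cauchy_schwarz rk pi0 m' w h.
have N0 := norm_ge0 rk pi m' h; have W0 := norm_ge0 rk pi m' w.
have kk : kR ^+ 2 * gamma <= kR ^+ 3 * gamma.
  by apply: ler_wpM2r => //; rewrite [kR ^+ 3]exprS ler_peMl // exprn_ge0 // ler0n.
have nk : n%:R * (3 * kR ^+ 2 * gamma) <= 3 * (kR ^+ 3 * gamma).
  rewrite (_ : 3 * (kR ^+ 3 * gamma) = kR * (3 * kR ^+ 2 * gamma)); last by ring.
  apply: ler_wpM2r; first by rewrite !mulr_ge0 ?exprn_ge0 ?ler0n.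
  by rewrite ler_nat leq_subr.
set N := nrm m' h in H Hw N0 *; set rr := (r k m')%:R^-1 in Hp *.
rewrite mul1r (_ : _ - _ = ip m' w h - (rr - p) * N ^+ 2); last by ring.
apply: le_trans (ler_normB _ _) _.
rewrite normrM (ger0_norm (sqr_ge0 N)).
have H1 : `|rr - p| * N ^+ 2 <= 3 * (kR ^+ 3 * gamma) * N ^+ 2.
  by apply: ler_wpM2r; rewrite ?sqr_ge0 //; apply: le_trans Hp nk.
have H2 : nrm m' w * N <= kR ^+ 2 * gamma * N ^+ 2.
  by rewrite expr2 mulrA; apply: ler_wpM2r.
have H3 : kR ^+ 2 * gamma * N ^+ 2 <= kR ^+ 3 * gamma * N ^+ 2.
  by apply: ler_wpM2r; rewrite ?sqr_ge0.
lra.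
Qed.

(** For j > 0, [gamma_small] makes the error in [norm_lift_approx] at most half of |h|^2 / Rmax. For
    j = 0, X(0) is a point, so h and its lift are the same constant, of equal norm. *)
Lemma sqr_norm_source_le j h : (j <= k)%N -> in_H rk pi j h ->
  nrm j h ^+ 2 <= 2 * Rm * nrm k (iter (k - j) up h) ^+ 2.
Proof.
case: j => [_ _|j jk hH].
  rewrite subn0 !sqr_norm //; have [b b0 _] := exists_pi_gt0 standX piX (leq0n d).
  have E i (u : X -> R) : (i <= d)%N -> (forall x, rk x = i -> u x = h b) ->
      ip i u u = h b ^+ 2.
    move=> id uE; rewrite -[RHS]mulr1 -(expect1 standX piX id) mulr_sumr.
    by apply: eq_bigr => x /eqP xi; rewrite uE //; ring.
  rewrite (E 0%N) // => [|x x0]; last by rewrite (rk0_unique standX x0 b0).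
  rewrite (E k) // => [|x xk].
    by rewrite ler_peMl ?sqr_ge0 //; have := Rm_ge1; lra.
  rewrite -[RHS](iter_up_const standX (i := 0) _ xk) //.
  apply: (@eq_iter_up _ _ _ _ _ _ 0) => // y y0.
  by rewrite (rk0_unique standX y0 b0).
have := norm_lift_approx (j := j.+1) jk hH.
rewrite ler_norml => /andP[+ _].
set H := nrm _ h ^+ 2; set G := nrm k _ ^+ 2 => HG.
have H0 : 0 <= H by apply: sqr_ge0.
have Rm0 : 0 < Rm by apply: lt_le_trans Rm_ge1.
have r0 : 0 < (r k j.+1)%:R :> R by apply: lt_le_trans (r_ge1 jk).
have h1 : Rm^-1 * H <= (r k j.+1)%:R^-1 * H.
  by apply: ler_wpM2r => //; rewrite lef_pV2 ?posrE // r_le_Rmax.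
rewrite -(ler_pM2l (_ : 0 < Rm^-1)) ?invr_gt0 //.
have -> : Rm^-1 * (2 * Rm * G) = 2 * G by field; rewrite gt_eqF.
have h2 : 8 * (kR ^+ 3 * gamma) * H <= Rm^-1 * H.
  apply: ler_wpM2r => //; rewrite -(ler_pM2l Rm0) divff ?gt_eqF //.
  by move: gamma_small; lra.
lra.
Qed.

(** Moving U^(k-j) across leaves D^n U^n h_j, which is nearly p h_j; and h_j is orthogonal to [u], a
    lift from a rank below j, because D h_j = 0. *)
Lemma inner_lift_le i j hi hj : (i < j <= k)%N ->
  in_H rk pi i hi -> in_H rk pi j hj ->
  `|ip k (iter (k - i) up hi) (iter (k - j) up hj)| <=
  Rm * kR ^+ 2 * gamma * (nrm k (iter (k - i) up hi) ^+ 2 + nrm k (iter (k - j) up hj) ^+ 2).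
Proof.
case: j => // m imk hiH hjH; have mk : (0 < m.+1 <= k)%N by lia.
have Hd := norm_downup_in_H mk hjH.
have Hi : nrm i hi ^+ 2 <= _ := sqr_norm_source_le (_ : i <= k)%N hiH.
have Hj : nrm m.+1 hj ^+ 2 <= _ := sqr_norm_source_le (_ : m.+1 <= k)%N hjH.
move/(_ ltac:(lia)): Hi => Hi; move/(_ ltac:(lia)): Hj => Hj.
set G := nrm k _ ^+ 2 in Hi *; set G' := nrm k _ ^+ 2 in Hj *.
set n := (k - m.+1)%N in Hd *; set p := pcoef _ _ _ in Hd.
have -> : (k - i = n + (m - i).+1)%N by rewrite /n; lia.
rewrite iterD; set u := iter (m - i).+1 up hi.
have kE : (k = m.+1 + n)%N by rewrite /n; lia.
rewrite [X in ip X]kE (inner_iter_up standX piX) -?kE //.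
pose w x := iter n down (iter n up hj) x - p * hj x; rewrite -/w in Hd.
have -> : ip m.+1 u (iter n down (iter n up hj)) = ip m.+1 u w.
  rewrite innerC (@eq_inner _ _ _ _ _ _ _ (fun x => 1 * w x + p * hj x) _ u) //.
    rewrite inner_lin mul1r (innerC _ _ _ hj) /u /= (inner_up standX piX); last by lia.
    rewrite (_ : ip m _ _ = 0); first by rewrite mulr0 addr0 innerC.
    by apply: big1 => x /eqP xm; rewrite hjH // mulr0.
  by move=> x _; rewrite /w; ring.
apply: le_trans (cauchy_schwarz rk pi0 _ _ _) _.
have Hu : nrm m.+1 u <= nrm i hi.
  rewrite (_ : m.+1 = i + (m - i).+1)%N; last by lia.
  by apply: (norm_iter_up standX piX); lia.
have := norm_ge0 rk pi m.+1 hj; have := norm_ge0 rk pi i hi.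
have := norm_ge0 rk pi m.+1 u; have := norm_ge0 rk pi m.+1 w.
set A := nrm i hi in Hi Hu *; set B := nrm m.+1 hj in Hj Hd *.
set U := nrm m.+1 u in Hu *; set W := nrm m.+1 w in Hd *.
move=> W0 U0 A0 B0.
have e0 : 0 <= kR ^+ 2 * gamma by rewrite mulr_ge0 ?exprn_ge0 ?ler0n.
apply: (@le_trans _ _ (A * (kR ^+ 2 * gamma * B))); first exact: ler_pM.
have -> : A * (kR ^+ 2 * gamma * B) = kR ^+ 2 * gamma * (A * B) by ring.
have -> : Rm * kR ^+ 2 * gamma * (G + G') = kR ^+ 2 * gamma * (Rm * (G + G')) by ring.
apply: ler_wpM2l => //.
(* A B <= (A^2 + B^2) / 2 <= Rmax (G + G'), by [Hi] and [Hj]. *)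
have := sqr_ge0 (A - B); nra.
Qed.

(** By adjointness <f, g> = <D^k_i f, h>, and E f may be subtracted because h is orthogonal to 1 = U
    1, as D h = 0. *)
Lemma inner_lift_deviation_le i f g h : (0 < i <= k)%N -> in_H rk pi i h ->
  (forall x, rk x = k -> g x = up_iter rk r k i h x) ->
  `|ip k f g| <=
  nrm i (fun x => down_iter rk pi k i f x - expect k f) * nrm i h.
Proof.
move=> ik hH gE; have iE : (i + (k - i) = k)%N by lia.
set u := fun x => _ - _; rewrite (_ : ip k f g = ip i u h); first exact: cauchy_schwarz.
rewrite innerC (eq_inner _ gE (fun x _ => erefl)) -{1}iE /up_iter.
rewrite (inner_iter_up standX piX) ?iE // innerC.
have h0 : ip i (fun=> 1) h = 0.
  case: {+}i ik hH => // m mk hH.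
  rewrite (@eq_inner _ _ _ _ _ _ _ (up (fun=> 1)) _ h) //; last first.
    by move=> x xm; rewrite (up1 standX _ xm) //; lia.
  rewrite (inner_up standX piX); last by lia.
  by apply: big1 => x /eqP xm; rewrite hH // mulr0.
transitivity (1 * ip i (down_iter rk pi k i f) h + (- expect k f) * ip i (fun=> 1) h).
  by rewrite h0 mulr0 addr0 mul1r.
by rewrite -inner_lin; apply: eq_inner => // x _; rewrite /u; ring.
Qed.

(** * The components of f *)

Section Components.
Context (f : X -> R) (fs : nat -> X -> R).
Hypothesis decf : HD_level_set_decomposition rk r pi k f fs.

Lemma inner_components_le i j : (i <= k)%N -> (j <= k)%N -> i != j ->
  `|ip k (fs i) (fs j)| <=
  Rm * kR ^+ 2 * gamma * (nrm k (fs i) ^+ 2 + nrm k (fs j) ^+ 2).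
Proof.
have [decV _] := decf.
wlog ij : i j / (i < j)%N.
  move=> H ik jk ij; case: (ltngtP i j) ij => // ij _; first by apply: H; rewrite ?ltn_eqF.
  by rewrite innerC addrC; apply: H; rewrite ?ltn_eqF.
move=> ik jk _; have [hi hiH fi] := decV _ ik; have [hj hjH fj] := decV _ jk.
rewrite (eq_inner _ fi fj) (eq_norm _ fi) (eq_norm _ fj).
by apply: inner_lift_le; rewrite // ij.
Qed.

Let eta := Rm * kR ^+ 2 * gamma.
Let G i := nrm k (fs i) ^+ 2.
Let S := \sum_(i < k.+1) G i.

Let eta0 : 0 <= eta.
Proof. by rewrite !mulr_ge0 ?exprn_ge0 ?ler0n. Qed.
Let G0 i : 0 <= G i. Proof. exact: sqr_ge0. Qed.
Let S0 : 0 <= S. Proof. by apply: sumr_ge0. Qed.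
Let eta_small : 8 * (kR * eta) <= 1.
Proof. by move: gamma_small; rewrite /eta; lra. Qed.

(** Expanding f, the term j = i is [G i] and each other term is at most eta (G j + G i). Adding back
    j = i gives eta (S + (k+1) G i), and k + 1 <= 2k. *)
Lemma inner_component_approx i : (i <= k)%N ->
  `|ip k f (fs i) - G i| <= eta * (2 * kR * G i + S).
Proof.
move=> ik; have [_ fE] := decf; rewrite -ltnS in ik; pose i' := Ordinal ik.
have -> : ip k f (fs i) = \sum_(j < k.+1) ip k (fs j) (fs i).
  rewrite /inner exchange_big /=; apply: eq_bigr => x /eqP xk.
  by rewrite fE // mulr_sumr mulr_suml.
rewrite (bigD1 i') //= -sqr_norm // -/(G i) addrAC subrr add0r.
apply: le_trans (ler_norm_sum _ _ _) _.
apply: (@le_trans _ _ (\sum_(j < k.+1) eta * (G j + G i))).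
  rewrite [leRHS](bigD1 i') //= ler_wpDl ?mulr_ge0 ?addr_ge0 //.
  apply: ler_sum => j ji; apply: inner_components_le => //; by rewrite -ltnS.
rewrite -mulr_sumr ler_wpM2l // big_split /= -/S addrC lerD2r sumr_const card_ord.
rewrite -[G i *+ _]mulr_natl ler_wpM2r // -addn1 natrD -/kR; have := k1; lra.
Qed.

(** Summing [inner_component_approx] gives |f|^2 >= S - (3k + 1) eta S, and 8 k eta <= 1 leaves at
    least S / 2. *)
Lemma sum_components_le : S <= 2 * nrm k f ^+ 2.
Proof.
have [_ fE] := decf.
have e : nrm k f ^+ 2 = \sum_(i < k.+1) ip k f (fs i).
  rewrite sqr_norm // /inner exchange_big /=; apply: eq_bigr => x /eqP xk.
  by rewrite -mulr_sumr -fE.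
have H : \sum_(i < k.+1) (G i - eta * (2 * kR * G i + S)) <= nrm k f ^+ 2.
  rewrite e; apply: ler_sum => i _.
  have /inner_component_approx : (i <= k)%N by rewrite -ltnS.
  by rewrite ler_norml => /andP[+ _]; lra.
move: H; rewrite sumrB -mulr_sumr big_split /= -mulr_sumr -/S sumr_const card_ord.
rewrite -[S *+ _]mulr_natl -addn1 natrD -/kR.
have h1 : eta * S <= kR * eta * S by rewrite ler_wpM2r // ler_peMl.
have h2 : kR * eta * S <= 8^-1 * S by rewrite ler_wpM2r //; move: eta_small; lra.
lra.
Qed.

(** With a = <f, f_i>, H = |h| and y the error term, |a| <= N H and H^2 <= R(k,i) (|a| + y) combine
    into a quadratic inequality that forces |a| <= R(k,i) N^2 + y. *)
Lemma inner_component_le i : (0 < i <= k)%N ->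
  `|ip k f (fs i)| <=
  (r k i)%:R * nrm i (fun x => down_iter rk pi k i f x - expect k f) ^+ 2
  + 22 * (Rm * kR ^+ 3 * gamma) * nrm k f ^+ 2.
Proof.
move=> ik; have ik' : (i <= k)%N by lia.
have [decV _] := decf; have [h hH fi] := decV _ ik'.
have Ha := inner_component_approx ik'.
have HS := sum_components_le.
have GS : G i <= S.
  rewrite -ltnS in ik'; rewrite /S (bigD1 (Ordinal ik')) //= lerDl.
  by apply: sumr_ge0.
have Hs := sqr_norm_source_le ik' hH.
have := norm_lift_approx ik hH; rewrite ler_norml => /andP[Hl _].
rewrite -(eq_norm _ fi) -/(G i) in Hs Hl.
set g := fun x => _ - _; set N := nrm i g.
have HN : `|ip k f (fs i)| <= N * nrm i h by exact: inner_lift_deviation_le.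
have r0 : 0 < (r k i)%:R :> R by apply: lt_le_trans (r_ge1 ik').
set F := nrm k f ^+ 2 in HS *; set H := nrm i h in Hs Hl HN *.
set a := ip k f (fs i) in Ha HN *; set ka := Rm * kR ^+ 3 * gamma.
have kaE : ka = kR * eta by rewrite /ka /eta; ring.
have ka0 : 0 <= ka by rewrite kaE mulr_ge0 ?ler0n.
have e1 : eta * (2 * kR * G i + S) <= 6 * ka * F.
  have : eta * (2 * kR * G i) <= eta * (2 * kR * S).
    by do 2!(apply: ler_wpM2l; rewrite ?mulr_ge0 ?ler0n //).
  have : eta * S <= kR * eta * S by rewrite ler_wpM2r // ler_peMl.
  have : kR * eta * S <= kR * eta * (2 * F) by rewrite ler_wpM2l // mulr_ge0 ?ler0n.
  by rewrite kaE; lra.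
have e2 : 4 * (kR ^+ 3 * gamma) * H ^+ 2 <= 16 * ka * F.
  have e30 : 0 <= kR ^+ 3 * gamma by rewrite mulr_ge0 ?exprn_ge0 ?ler0n.
  have : kR ^+ 3 * gamma * H ^+ 2 <= kR ^+ 3 * gamma * (2 * Rm * (2 * F)).
    apply: ler_wpM2l => //; apply: le_trans Hs _; apply: ler_wpM2l; last by lra.
    by rewrite mulr_ge0 ?ler0n.
  by rewrite /ka; lra.
have Ga : G i <= `|a| + 6 * ka * F.
  by have := ler_norm a; move: Ha; rewrite ler_norml => /andP[]; lra.
(* 22 = 6 + 16, from [e1] and [e2]. *)
have HH : H ^+ 2 <= (r k i)%:R * (`|a| + 22 * ka * F).
  by rewrite -ler_pdivrMl //; lra.
have F0 : 0 <= F by apply: sqr_ge0.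
have N0 := norm_ge0 rk pi i g; rewrite -/N in N0.
have H0 := norm_ge0 rk pi i h; rewrite -/H in H0.
have y0 : 0 <= 22 * ka * F by rewrite -mulrA mulr_ge0 ?ler0n //; exact: mulr_ge0.
have aa : `|a| ^+ 2 <= N ^+ 2 * ((r k i)%:R * (`|a| + 22 * ka * F)).
  apply: (@le_trans _ _ ((N * H) ^+ 2)); first by rewrite ler_sqr ?nnegrE ?mulr_ge0.
  by rewrite exprMn ler_wpM2l ?sqr_ge0.
(* If b > q M + y, then b^2 > q M b + y b >= q M (b + y), since b >= q M; this contradicts [aa]. *)
rewrite leNgt; apply/negP; set y := 22 * ka * F in y0 aa *.
set q := (r k i)%:R in r0 aa *; have := normr_ge0 a.
set b := `|a| in aa *; set M := N ^+ 2 in aa *; have M0 : 0 <= M := sqr_ge0 N.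
have qM0 : 0 <= q * M by rewrite mulr_ge0 // ltW.
move=> b0 big; have b1 : 0 < b by lra.
have : b * (q * M + y) < b ^+ 2 by rewrite expr2 ltr_pM2l.
have : q * M * y <= b * y by rewrite ler_wpM2r //; lra.
lra.
Qed.

End Components.

(** * The deviation of D^k_i f from its mean *)

Lemma sqr_norm_deviation_le i f e : (i <= k)%N ->
  (forall x, rk x = i -> `|down_iter rk pi k i f x - expect k f| <= e) ->
  nrm i (fun x => down_iter rk pi k i f x - expect k f) ^+ 2 <= e ^+ 2.
Proof.
move=> ik He; have id : (i <= d)%N := leq_trans ik kd.
rewrite sqr_norm // -[leRHS]mulr1 -(expect1 standX piX id) mulr_sumr.
apply: ler_sum => x /eqP xi; rewrite mulr1 -mulrA mulrC -expr2; apply: ler_wpM2r => //.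
rewrite -real_normK ?num_real // ler_sqr ?nnegrE ?He //.
exact: le_trans (normr_ge0 _) (He x xi).
Qed.

(* The deviation g - E is orthogonal to constants, so |g - E|^2 = <g - E, g>,
   and sum pi |g| = |E| when g has constant sign. *)
Lemma sqr_norm_deviation_sign_le i f e : (i <= k)%N ->
  (forall x, rk x = i -> `|down_iter rk pi k i f x - expect k f| <= e) ->
  local_constant_sign rk pi k i f ->
  nrm i (fun x => down_iter rk pi k i f x - expect k f) ^+ 2 <= e * `|expect k f|.
Proof.
move=> ik He [E0 sgn]; have id : (i <= d)%N := leq_trans ik kd.
have iE : (i + (k - i) = k)%N := subnKC ik.
set g := down_iter rk pi k i f; set E := expect k f.
have Eg : expect i g = E.
  rewrite expectE innerC -(inner_iter_up standX piX) ?iE // innerC /E expectE.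
  by apply: eq_inner => // x xk; rewrite (iter_up_const standX (i := i)) ?iE.
rewrite sqr_norm //.
have -> : ip i (fun x => g x - E) (fun x => g x - E) = ip i (fun x => g x - E) g.
  transitivity (ip i (fun x => g x - E) g - E * (expect i g - E * expect i (fun=> 1))).
    rewrite /inner /Defs.expect !mulr_sumr -!sumrB mulr_sumr -sumrB.
    by apply: eq_bigr => x _; ring.
  by rewrite Eg (expect1 standX piX id) mulr1 subrr mulr0 subr0.
have -> : e * `|E| = \sum_(x | rk x == i) pi x * (e * `|g x|).
  (* |E| is the sign of E times E, and where pi x and g x are nonzero this is the sign of g x, the
     local average at x. *)
  rewrite normrEsg -{2}Eg /Defs.expect !mulr_sumr; apply: eq_bigr => x /eqP xi.
  have [->|px] := eqVneq (pi x) 0; first by rewrite !mul0r !mulr0.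
  have px0 : 0 < pi x by rewrite lt_neqAle eq_sym px pi0.
  have := local_expect_down standX piX (n := k - i) (s := x) f.
  rewrite xi iE => /(_ kd px0); rewrite -/(down_iter rk pi k i f) -/g => lE.
  have := sgn x xi; rewrite lE -/E => sg.
  have [->|gx] := eqVneq (g x) 0; first by rewrite normr0 !mulr0.
  rewrite -sg; last exact/eqP.
  by rewrite [`|g x|]normrEsg; ring.
apply: ler_sum => x /eqP xi; rewrite -mulrA ler_wpM2l //.
apply: le_trans (ler_norm _) _; rewrite normrM ler_wpM2r //; exact: He.
Qed.

End Decomposition.

(** * Choice of the constants and conclusion *)

Lemma delta_max_ge0_le1 (R : realType) d (delta : nat -> R) :
  delta 0%N = 0 -> (forall i, (1 <= i < d)%N -> 0 <= delta i <= 1) ->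
  0 <= delta_max d delta <= 1.
Proof.
move=> d0 dP; rewrite /delta_max big_seq.
apply: (big_ind (fun x => 0 <= x <= 1)); first by rewrite lexx ler01.
  by move=> x y xP yP; case: (leP x y).
move=> i; rewrite mem_index_iota => id.
have /andP[di0 di1] := dP i id.
have /andP[? ?] : 0 <= delta i.-1 <= 1.
  by clear di0 di1; case: i id => [//|[|i]] id; [rewrite d0 lexx ler01 | apply: dP; lia].
by apply/andP; split; nra.
Qed.

Theorem theorem5p7 (R : realType) :
  exists c0 C : R, 0 < c0 /\
  forall (disp : Order.disp_t) (X : finPOrderType disp)
    (d : nat) (rk : X -> nat) (r : nat -> nat -> nat) (pi : X -> R)
    (delta : nat -> R) (gamma : R) (k : nat),
  standing_poset d rk r ->
  induced_distribution d rk r pi ->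
  eposet d rk r pi delta gamma ->
  non_lazy d rk r pi gamma ->
  (k < d)%N ->
  gamma <= c0 * (delta_max d delta / (k%:R ^+ 5 * (Rmax r k)%:R ^+ 2)) ->
  exists c : R,
  c <= C * (k%:R ^+ 5 * (Rmax r k)%:R ^+ 2 / delta_max d delta) /\
  forall (f : X -> R) (fs : nat -> X -> R) (l : nat) (eps : nat -> R),
  HD_level_set_decomposition rk r pi k f fs ->
  (l <= k)%N ->
  linf_pseudorandom rk pi k l eps f ->
  forall i : nat, (1 <= i <= l)%N ->
    `|inner rk pi k f (fs i)| <=
      ((r k i)%:R + c * gamma) * eps i ^+ 2 + c * gamma * norm rk pi k f ^+ 2
    /\
    (local_constant_sign rk pi k i f ->
     `|inner rk pi k f (fs i)| <=
       ((r k i)%:R + c * gamma) * eps i * `|expect rk pi k f|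
         + c * gamma * norm rk pi k f ^+ 2).
Proof.
(* The 8 comes from [gamma_small], the 22 from [inner_component_le]. *)
exists 8^-1, 22; split; first by rewrite invr_gt0.
move=> disp X d rk r pi delta gamma k standX piX epoX lazyX kd gle.
exists (22 * (k%:R ^+ 5 * (Rmax r k)%:R ^+ 2 / delta_max d delta)).
split=> // f fs l eps decf lk psr i il.
have k0 : (0 < k)%N by lia.
have ik : (0 < i <= k)%N by lia.
have ik' : (i <= k)%N by lia.
have g0 : 0 <= gamma by apply: (gamma_ge0 standX piX lazyX); lia.
(* The bound D <= 1 makes gamma small in absolute terms, and division by D can then only increase
   the error term. *)
have /andP[dm0 dm1] := delta_max_ge0_le1 (eposet_delta0 epoX) (eposet_delta epoX).
set K := k%:R : R in gle *; set Rm := (Rmax r k)%:R : R in gle *.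
set D := delta_max d delta in gle dm0 dm1 *; set c := 22 * _.
have K1 : 1 <= K by rewrite ler1n.
have Rm1 : 1 <= Rm.
  apply: (@le_trans _ _ (r k 0)%:R); last exact: r_le_Rmax.
  by rewrite ler1n (r_gt0 standX) // ltnW.
have KR0 : 0 < K ^+ 5 * Rm ^+ 2.
  by rewrite mulr_gt0 ?exprn_gt0 // (lt_le_trans ltr01).
have le35 : Rm * K ^+ 3 <= K ^+ 5 * Rm ^+ 2.
  rewrite mulrC; apply: ler_pM; rewrite ?exprn_ge0 ?ler0n //.
    exact: ler_weXn2l.
  by rewrite expr2 ler_peMl // ler0n.
have gD : 8 * (K ^+ 5 * Rm ^+ 2 * gamma) <= D.
  have : K ^+ 5 * Rm ^+ 2 * gamma <= K ^+ 5 * Rm ^+ 2 * (8^-1 * (D / (K ^+ 5 * Rm ^+ 2))).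
    by rewrite ler_pM2l.
  have -> : K ^+ 5 * Rm ^+ 2 * (8^-1 * (D / (K ^+ 5 * Rm ^+ 2))) = 8^-1 * D.
    by rewrite mulrCA mulrC [_ * (D / _)]mulrC divfK ?gt_eqF // mulrC.
  lra.
have le35g : Rm * K ^+ 3 * gamma <= K ^+ 5 * Rm ^+ 2 * gamma by rewrite ler_wpM2r.
have gamma_small : 8 * (Rm * K ^+ 3 * gamma) <= 1 by lra.
have cg : 22 * (Rm * K ^+ 3 * gamma) <= c * gamma.
  (* If D = 0, then c is 0 by division by 0, but [gD] forces gamma = 0; for gamma > 0 it gives D >
     0. *)
  have [->|gn0] := eqVneq gamma 0; first by rewrite !mulr0.
  have gp : 0 < gamma by rewrite lt_neqAle eq_sym gn0.
  have Dp : 0 < D by apply: lt_le_trans gD; apply: mulr_gt0; rewrite ?ltr0n // mulr_gt0.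
  have : K ^+ 5 * Rm ^+ 2 * gamma <= K ^+ 5 * Rm ^+ 2 / D * gamma.
    by apply: ler_wpM2r => //; rewrite ler_pdivlMr // ler_piMr // ltW.
  by rewrite /c -(mulrA 22); move: (_ / D * gamma) => q; lra.
have cg0 : 0 <= c * gamma by apply: le_trans cg; rewrite !mulr_ge0 ?exprn_ge0 ?ler0n.
have main := inner_component_le standX piX epoX lazyX k0 kd gamma_small decf ik.
have dev := psr i il.
have F0 : 0 <= norm rk pi k f ^+ 2 by apply: sqr_ge0.
have tail : 22 * (Rm * K ^+ 3 * gamma) * norm rk pi k f ^+ 2
    <= c * gamma * norm rk pi k f ^+ 2.
  by rewrite ler_wpM2r.
have r0 : 0 <= (r k i)%:R :> R by rewrite ler0n.
split=> [|sgn]; apply: le_trans main _; apply: lerD => //.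
  rewrite mulrDl; apply: ler_wpDr; first by rewrite mulr_ge0 ?sqr_ge0.
  by apply: ler_wpM2l => //; apply: (sqr_norm_deviation_le standX piX kd ik' dev).
(* An element of rank i makes eps_i nonnegative, hence also the term c gamma eps_i |E f|. *)
have [x xi _] := exists_pi_gt0 standX piX (leq_trans ik' (ltnW kd)).
have e0 : 0 <= eps i := le_trans (normr_ge0 _) (dev x xi).
rewrite -mulrA mulrDl; apply: ler_wpDr; first by rewrite mulr_ge0 // mulr_ge0.
by apply: ler_wpM2l => //; apply: (sqr_norm_deviation_sign_le standX piX kd ik' dev).
Qed.
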